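(* Let $(X,\mathcal{B}(X),\mu)$ be a $\sigma$-finite measure space and let $\mathbb{I}\subseteq\mathbb{R}$ be such that $\#\mathbb{I}\ge2$. Let $k\ge2$ be an integer and let $p,r\in(1,\infty)$ be fixed. Let $(T_t)_{t\in\mathbb{I}^k}$ be a family of linear operators of the form $$T_t:=T^1_{t_1}\cdots T^k_{t_k},\qquad t=(t_1,\ldots,t_k)\in\mathbb{I}^k,$$ where $\{T^i_{t_i}:i\in\{1,\ldots,k\},\ t_i\in\mathbb{I}\}$ is a family of commuting linear operators $L^0(X)\to L^0(X)$ which are bounded on $L^p(X)$. If the set $\mathbb{I}$ is uncountable, assume also that $\mathbb{I}\ni t\mapsto T^i_tf$ is continuous $\mu$-almost everywhere on $X$ for every $f\in L^0(X)$ and $i\in\{1,\ldots,k\}$. Further assume that for every $i\in\{1,\ldots,k\}$ we have $$\sup_{J\in\mathbb{Z}_+}\sup_{I\in\mathfrak{S}_J(\mathbb{I})}\bigl\|O^r_{I,J}(T^i_tf:t\in\mathbb{I})\bigr\|_{L^p(X)}\lesssim_{p,r}\|f\|_{L^p(X)},\qquad f\in L^p(X),$$ and $$\Bigl\|\Bigl(\sum_{j\in\mathbb{Z}}\bigl(\sup_{t\in\mathbb{I}}|T^i_t||f_j|\bigr)^r\Bigr)^{1/r}\Bigr\|_{L^p(X)}\lesssim_{p,r}\Bigl\|\Bigl(\sum_{j\in\mathbb{Z}}|f_j|^r\Bigr)^{1/r}\Bigr\|_{L^p(X)},\qquad(f_j)_{j\in\mathbb{Z}}\in L^p(X;\ell^r(\mathbb{Z})).$$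 Then the following multi-parameter $r$-oscillation estimate holds: $$\sup_{J\in\mathbb{Z}_+}\sup_{I\in\mathfrak{S}_J(\mathbb{I}^k)}\bigl\|O^r_{I,J}(T_tf:t\in\mathbb{I}^k)\bigr\|_{L^p(X)}\lesssim\|f\|_{L^p(X)},\qquad f\in L^p(X).$$
   Context: $L^0(X)$ is the space of all $\mu$-measurable functions $f:X\to\mathbb{C}$. For a linear operator $T:L^0(X)\to L^0(X)$, $|T|$ denotes the sublinear maximal operator taken in the lattice sense, $|T|f(x)=\sup_{|g|\le|f|}|Tg(x)|$ for $x\in X$, $f\in L^p(X)$. $A\lesssim B$ means $A\le CB$ with a constant $C>0$ independent of $f$, $(f_j)$, $J$, $I$; subscripts indicate parameters on which $C$ depends. For $x,y\in\mathbb{R}^m$ write $x\prec_{\rm s}y$ iff $x_i<y_i$ for every $i$. For $\mathbb{A}\subseteq\mathbb{R}^m$ and $J\in\mathbb{Z}_+$, $\mathfrak{S}_J(\mathbb{A})$ is the set of all sequences $I=(I_0,\ldots,I_J)$ in $\mathbb{A}$ with $I_0\prec_{\rm s}I_1\prec_{\rm s}\cdots\prec_{\rm s}I_J$. For $I_j=(I_{j1},\ldots,I_{jm})$ put $\mathbb{B}[I_j]:=[I_{j1},I_{(j+1)1})\times\cdots\times[I_{jm},I_{(j+1)m})$. For a family $(\mathfrak{a}_t:t\in\mathbb{A})$ of complex-valued measurable functions on $X$ and $1\le r<\infty$, $$O^r_{I,J}(\mathfrak{a}_t(x):t\in\mathbb{A}):=\Bigl(\sum_{j=0}^{J-1}\sup_{t\in\mathbb{B}[I_j]\cap\mathbb{A}}|\mathfrak{a}_t(x)-\mathfrak{a}_{I_j}(x)|^r\Bigr)^{1/r}.$$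 (This is used with $m=1$, $\mathbb{A}=\mathbb{I}$ and with $m=k$, $\mathbb{A}=\mathbb{I}^k$. A supremum over the empty set is zero. As a standing convention to avoid measurability problems, $t\mapsto\mathfrak{a}_t(x)$ is assumed continuous for $\mu$-almost every $x$, or the index set is countable.) *)

(* Defs.v *)
From HB Require Import structures.
From mathcomp Require Export all_boot all_order all_algebra.
From mathcomp Require Export complex.
From mathcomp Require Export all_classical all_reals all_analysis.
From mathcomp Require Export measurable_realfun.
Export Order.TTheory GRing.Theory Num.Theory.
Export numFieldNormedType.Exports.

Set Implicit Arguments.
Unset Strict Implicit.
Unset Printing Implicit Defensive.

#[export] Set Implicit Arguments.
#[export] Unset Strict Implicit.
#[export] Unset Printing Implicit Defensive.

Local Open Scope classical_set_scope.
Local Open Scope ring_scope.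

(* [`|z|] lives in [R[i]]; [cabs z] is the same number as an extended real. *)
Definition cabs (R : realType) (z : R[i]) : \bar R :=
  (ComplexField.Normc.normc z)%:E.

Section Functions.
Context (d : measure_display) (X : measurableType d) (R : realType).
Variable mu : {measure set X -> \bar R}.
Implicit Types (f g : X -> R[i]) (p : R).

(* Elements of L^0(X) are represented by functions, equal elements by functions
   that agree almost everywhere.  The notion of mu-measurability is the one
   that is stable under modification on a null set. *)
Definition L0 f : Prop :=
  exists g, [/\ measurable_fun [set: X] (fun x => complex.Re (g x)),
                measurable_fun [set: X] (fun x => complex.Im (g x))
              & {ae mu, forall x, f x = g x}].

Definition Lp_norm p f : \bar R := 'N[mu]_p%:E[(@cabs R) \o f]%E.

Definition Lp p f : Prop := L0 f /\ (Lp_norm p f < +oo)%E.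

(* Linear operators L^0(X) -> L^0(X); [L0_op_congr] says that T is well defined
   on classes of functions modulo almost everywhere equality. *)
Record L0_operator (T : (X -> R[i]) -> (X -> R[i])) : Prop := {
  L0_op_stable : forall f, L0 f -> L0 (T f);
  L0_op_congr : forall f g, L0 f -> L0 g ->
    {ae mu, forall x, f x = g x} -> {ae mu, forall x, T f x = T g x};
  L0_op_linear : forall (c : R[i]) f g, L0 f -> L0 g ->
    {ae mu, forall x, T (fun y => c * f y + g y) x = c * T f x + T g x} }.

Definition L0_commute (S T : (X -> R[i]) -> (X -> R[i])) : Prop :=
  forall f, L0 f -> {ae mu, forall x, S (T f) x = T (S f) x}.

Definition Lp_bounded p (T : (X -> R[i]) -> (X -> R[i])) : Prop :=
  exists C : R, 0 < C /\
    forall f, Lp p f -> (Lp_norm p (T f) <= C%:E * Lp_norm p f)%E.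

(* Supremum in the lattice of extended real measurable functions modulo almost
   everywhere equality.  It exists when mu is sigma-finite and is unique up to
   a null set. *)
Definition is_lattice_sup (F : set (X -> \bar R)) (h : X -> \bar R) : Prop :=
  [/\ measurable_fun [set: X] h,
      forall u, F u -> {ae mu, forall x, (u x <= h x)%E}
    & forall h' : X -> \bar R, measurable_fun [set: X] h' ->
        (forall u, F u -> {ae mu, forall x, (u x <= h' x)%E}) ->
        {ae mu, forall x, (h x <= h' x)%E}].

Definition lattice_sup (F : set (X -> \bar R)) : X -> \bar R :=
  get (is_lattice_sup F).

(* |T| f = sup_{|g| <= |f|} |T g| *)
Definition abs_op (T : (X -> R[i]) -> (X -> R[i])) f : X -> \bar R :=
  lattice_sup [set (fun x => cabs (T g x)) |
    g in [set g | L0 g /\ {ae mu, forall x, (cabs (g x) <= cabs (f x))%E}]].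

(* sup_{t in I} |T_t| f *)
Definition max_op (I : set R) (T : R -> (X -> R[i]) -> (X -> R[i])) f :
    X -> \bar R :=
  lattice_sup [set abs_op (T t) f | t in I].

(* || (sum_{j in Z} |u_j|^r)^{1/r} ||_{L^p} *)
Definition Lp_lr_norm p (r : R) (u : int -> X -> \bar R) : \bar R :=
  'N[mu]_p%:E[(fun x => (\esum_(j in [set: int]) (`|u j x| `^ r)) `^ r^-1)]%E.

Definition vector_valued_max_bound p (r : R) (I : set R)
    (T : R -> (X -> R[i]) -> (X -> R[i])) : Prop :=
  exists C : R, 0 < C /\
    forall f : int -> X -> R[i],
      (forall j, L0 (f j)) ->
      (Lp_lr_norm p r (fun j x => cabs (f j x)) < +oo)%E ->
      (Lp_lr_norm p r (fun j => max_op I T (fun x => `|f j x|%R)) <=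
       C%:E * Lp_lr_norm p r (fun j x => cabs (f j x)))%E.

(* [a] is a choice of representatives of the elements [F t], t in A, of L^0(X). *)
Definition is_version (S : Type) (A : set S) (F a : S -> X -> R[i]) : Prop :=
  forall t, A t -> {ae mu, forall x, a t x = F t x}.

(* t |-> a_t(x) is continuous on A for almost every x; complex numbers carry the
   topology of R x R. *)
Definition ae_continuous (S : topologicalType) (A : set S)
    (a : S -> X -> R[i]) : Prop :=
  {ae mu, forall x, {within A, continuous (fun t => complex.Re (a t x))} /\
                    {within A, continuous (fun t => complex.Im (a t x))}}.

End Functions.

(* Points of R^m are row vectors, so t_i is [t ord0 i].  The one-parameter case
   is the case m = 1. *)
Section Oscillation.
Context (R : realType).

Definition strictly_below (m : nat) (x y : 'rV[R]_m) : Prop :=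
  forall i, x ord0 i < y ord0 i.

Definition set_pow (I : set R) (m : nat) : set 'rV[R]_m :=
  [set t | forall i, I (t ord0 i)].

(* S_J(A); only the entries I_0, ..., I_J of [I : nat -> 'rV[R]_m] are used. *)
Definition increasing_seqs (m : nat) (A : set 'rV[R]_m) (J : nat) :
    set (nat -> 'rV[R]_m) :=
  [set I | (forall j, (j <= J)%N -> A (I j)) /\
           (forall j, (j < J)%N -> strictly_below (I j) (I j.+1))].

Definition box (m : nat) (x y : 'rV[R]_m) : set 'rV[R]_m :=
  [set t | forall i, x ord0 i <= t ord0 i < y ord0 i].

Definition oscillation (X : Type) (r : R) (m : nat) (A : set 'rV[R]_m)
    (I : nat -> 'rV[R]_m) (J : nat) (a : 'rV[R]_m -> X -> R[i]) (x : X) :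
    \bar R :=
  ((\sum_(j < J) ereal_sup [set cabs (a t x - a (I j) x)%R `^ r |
                            t in box (I j) (I j.+1) `&` A]) `^ r^-1)%E.

(* sup_J sup_{I in S_J(A)} || O^r_{I,J}(F_t f : t in A) ||_p <= C ||f||_p.
   The pointwise suprema in O^r depend on the representatives of the elements
   F_t f of L^0(X) unless A is countable or the representatives depend
   continuously on t almost everywhere.  The bound is required of all
   representatives that satisfy this standing convention. *)
Definition oscillation_bound (d : measure_display) (X : measurableType d)
    (mu : {measure set X -> \bar R}) (p r : R) (m : nat) (A : set 'rV[R]_m)
    (F : 'rV[R]_m -> (X -> R[i]) -> (X -> R[i])) : Prop :=
  exists C : R, 0 < C /\
    forall f, Lp mu p f ->
    forall a, is_version mu A (fun t => F t f) a ->
      countable A \/ ae_continuous mu A a ->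
      (ereal_sup [set ereal_sup [set 'N[mu]_p%:E[oscillation r A I J a] |
                                 I in increasing_seqs A J] |
                  J in [set J | (0 < J)%N]]
       <= C%:E * Lp_norm mu p f)%E.

(* T_t = T^1_{t_1} ... T^k_{t_k} *)
Definition product_op (X : Type) (k : nat)
    (T : 'I_k -> R -> (X -> R[i]) -> (X -> R[i])) (t : 'rV[R]_k) :
    (X -> R[i]) -> (X -> R[i]) :=
  \big[(fun S U => S \o U)/id]_(i < k) T i (t ord0 i).

End Oscillation.

(* Main.v *)
Require Import Defs.
Local Open Scope classical_set_scope.
Local Open Scope ring_scope.

(** Fix an increasing sequence I_0, ..., I_J in the product index set.  For t in
    the box at u = I_j the difference T_t f - T_u f telescopes: one parameter is
    changed at a time, and since the operators commute each summand is a product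
    of the other one-parameter operators applied to a one-parameter difference
    (T^i_(t_i) - T^i_(u_i)) f.  The supremum over t_i of this difference is
    controlled, in L^p(l^r) with respect to j, by the one-parameter oscillation
    inequality for T^i.  The remaining operators are bounded pointwise by their
    maximal operators sup_t |T^l_t|, which preserve L^p(l^r) by the
    vector-valued maximal inequalities.

    The argument is organized around majorants, i.e. families G_j of nonnegative
    measurable functions with a bound on their energy, the p-th power of the
    L^p(l^r) norm.  The lemma [maximal_step] turns a majorant of functions g_j
    into a majorant of all the T^l_t g_j; [oscillation_step] gives a majorant of
    the one-parameter differences; the telescoping is the induction over the
    list of factors in [list_op_oscillation].

    Two points need care.  The maximal operators are suprema in the lattice of
    measurable functions modulo null sets, and using their defining property
    requires that these exist: [lattice_supP] proves this on a sigma-finite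
    space, by exhaustion.  The domination obtained for each t holds outside a
    null set that depends on t, whereas the oscillation is a pointwise supremum
    over uncountably many t; [version_bound] removes this dependence by
    continuity in t.  As the oscillation itself need not be measurable, its norm
    is a lower integral, which is still monotone ([ae_le_lower_integral]). *)

(** * Lower integrals *)

Section lower_integral.
Local Open Scope ereal_scope.
Context d (X : measurableType d) (R : realType)
  (mu : {measure set X -> \bar R}).
Import HBNNSimple.

(** The integral of a nonnegative function is the supremum of the integrals of
    the simple functions below it, measurable or not.  This monotonicity without
    measurability is essential: the oscillation is a supremum over an
    uncountable set and need not be measurable. *)
Lemma ae_le_lower_integral (u v : X -> \bar R) :
  (forall x, 0 <= u x) -> (forall x, 0 <= v x) ->
  {ae mu, forall x, u x <= v x} -> \int[mu]_x u x <= \int[mu]_x v x.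
Proof.
move=> u0 v0 [N [mN N0 uvN]].
rewrite !ge0_integralTE//.
apply: ge_ereal_sup => _ [h /= hu <-].
(* A simple function below u lies below v once it is cut off on the null set. *)
pose h' := mul_nnsfun h (indic_nnsfun R (measurableC mN)).
have h'E x : h' x = (h x * \1_(~` N) x)%R by [].
apply: (@le_trans _ _ (sintegral mu h')); last first.
  apply: ereal_sup_ubound; exists h' => // x.
  rewrite h'E indicE; case: (boolP (x \in ~` N)) => xN.
    rewrite mulr1 (le_trans (hu x))//.
    by apply: contrapT => uv; move: xN; rewrite inE; apply; exact: uvN.
  by rewrite mulr0 v0.
rewrite -!integralT_nnsfun.
apply: ae_ge0_le_integral => //.
- by move=> x _; rewrite lee_fin.
- exact/measurable_EFinP.
- by move=> x _; rewrite lee_fin.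
- exact/measurable_EFinP.
exists N; split => // x /= /not_implyP[_ H]; apply: contrapT => xN; apply: H.
by change ((h x)%:E <= (h' x)%:E); rewrite h'E indicE mem_set// mulr1.
Qed.

End lower_integral.

(** * Essential suprema on sigma-finite spaces *)

Section esssup.
Local Open Scope ereal_scope.
Context d (X : measurableType d) (R : realType).

Lemma ae_countable (mu : {measure set X -> \bar R}) (S : Type) (D : set S)
    (P : S -> X -> Prop) : countable D ->
  (forall t, D t -> {ae mu, forall x, P t x}) ->
  {ae mu, forall x, forall t, D t -> P t x}.
Proof.
move=> /countable_injP[e e_inj] DP.
have : {ae mu, forall x, forall n, forall t, D t -> e t = n -> P t x}.
  apply: ae_foralln => n.
  have [[t [Dt <-]]|nD] := pselect (exists t, D t /\ e t = n).
    apply: filterS (DP t Dt) => x Ptx s Ds.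
    by move=> /(e_inj _ _ (mem_set Ds) (mem_set Dt)) ->.
  by apply: filterE => x s Ds es; case: nD; exists s.
by apply: filterS => x H t Dt; exact: H Dt erefl.
Qed.

(** Exhaustion: a sequence of sequences whose unions come arbitrarily close to
    the largest possible measure inside E merges into one sequence whose union
    attains it; a further member of the family then adds only a null set. *)
Lemma essential_union (mu : {measure set X -> \bar R}) (E : set X)
    (A : set (set X)) :
  measurable E -> mu E < +oo -> A !=set0 -> A `<=` measurable ->
  exists B : nat -> set X, (forall n, A (B n)) /\
    forall S, A S -> mu (E `&` (S `\` \bigcup_n B n)) = 0.
Proof.
move=> mE Efin [A0 AA0] Am.
pose V (B : nat -> set X) := mu (E `&` \bigcup_n B n).
pose Sg := [set V B | B in [set B | forall n, A (B n)]].
have mB (B : nat -> set X) :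
    (forall n, A (B n)) -> measurable (E `&` \bigcup_n B n).
  move=> AB; apply: measurableI => //.
  by apply: bigcupT_measurable => n; exact: Am.
have SgE : ereal_sup Sg <= mu E.
  apply: ge_ereal_sup => _ [B AB <-]; rewrite /V le_measure ?inE//.
  exact: mB.
have Sg0 : 0 <= ereal_sup Sg.
  apply: (@le_trans _ _ (V (fun=> A0))); first exact: measure_ge0.
  by apply: ereal_sup_ubound; exists (fun=> A0).
have Sgfin : ereal_sup Sg \is a fin_num.
  by rewrite ge0_fin_numE// (le_lt_trans SgE).
have BS m : {B : nat -> set X | (forall n, A (B n)) /\
    ereal_sup Sg - (m.+1%:R^-1)%:E < V B}.
  apply/cid; have [|_ [B AB <-] ltB] :=
    @ub_ereal_sup_adherent R Sg (m.+1%:R^-1)%R _ Sgfin.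
    by rewrite invr_gt0.
  by exists B.
pose C k := if @unpickle (nat * nat)%type k is Some mn then
  sval (BS mn.1) mn.2 else A0.
have AC k : A (C k).
  rewrite /C; case: unpickle => [[m n]|//] /=.
  by case: (svalP (BS m)) => + _; apply.
exists C; split=> // S AS.
have VC : ereal_sup Sg <= V C.
  apply/lee_addgt0Pr => e e0.
  have [m me] : exists m, (m.+1%:R^-1 < e)%R.
    by exists (Num.truncn e^-1); rewrite invf_plt ?posrE// truncnS_gt.
  have [AB ltB] := svalP (BS m).
  rewrite -leeBlDr//; apply: le_trans (le_trans (ltW ltB) _); last first.
    rewrite /V le_measure ?inE//; [exact: mB|exact: mB|].
    apply: setIS => x [n _ Bx]; exists (pickle (m, n)) => //.
    by rewrite /C pickleK.
  by rewrite leeB// lee_fin ltW.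
(* D is C with S put in front, so that its union has at most maximal measure. *)
pose D k := if k is k'.+1 then C k' else S.
have AD k : A (D k) by case: k.
have VD : V D <= ereal_sup Sg by apply: ereal_sup_ubound; exists D.
have DE : E `&` \bigcup_n D n =
    (E `&` \bigcup_n C n) `|` (E `&` (S `\` \bigcup_n C n)).
  apply/seteqP; split => x.
    move=> [Ex [[|n] _ Dx]].
      have [Cx|nCx] := pselect ((\bigcup_n C n) x); first by left.
      by right; split=> //.
    by left; split=> //; exists n.
  move=> [[Ex [n _ Cx]]|[Ex [Sx _]]]; split=> //; first by exists n.+1.
  by exists 0%N.
have mEC := mB _ AC.
have mES : measurable (E `&` (S `\` \bigcup_n C n)).
  apply: measurableI => //; apply: measurableD; first exact: Am.
  by apply: bigcupT_measurable => n; exact: Am.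
have := le_trans VD VC; rewrite /V DE measureU//; last first.
  by apply/seteqP; split=> // x [[_ Cx] [_ [_]]].
move=> H; apply/eqP; rewrite -measure_le0.
have VCfin : V C \is a fin_num.
  rewrite ge0_fin_numE ?measure_ge0// (le_lt_trans _ Efin)//.
  by rewrite le_measure ?inE//; exact: subIsetl.
by move: H; rewrite -[leRHS]adde0 leeD2lE.
Qed.

Lemma ereal_lt_rat (x y : \bar R) : x < y ->
  exists q : rat, x <= (ratr q)%:E < y.
Proof.
case: x y => [x| |] [y| |]//= xy.
- have [q] := @rat_in_itvoo R x y xy; rewrite in_itv /= => /andP[xq qy].
  by exists q; rewrite lee_fin lte_fin ltW.
- have [|q] := @rat_in_itvoo R x (x + 1).
  by rewrite ltrDl.
  rewrite in_itv /= => /andP[xq qy].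
  by exists q; rewrite lee_fin ltry ltW.
- have [|q] := @rat_in_itvoo R (y - 1) y.
  by rewrite gtrBl.
  rewrite in_itv /= => /andP[xq qy].
  by exists q; rewrite leNye lte_fin.
- by exists 0%R; rewrite leNye ltry.
Qed.

(** Measurability with respect to the completed sigma-algebra, as in L0. *)
Definition ae_measurable (mu : {measure set X -> \bar R}) (u : X -> \bar R) :=
  exists2 v, measurable_fun [set: X] v & {ae mu, forall x, u x = v x}.

Context (mu : {sigma_finite_measure set X -> \bar R}).

(** Countably many superlevel sets determine a function.  For each rational q
    the sets where v exceeds q, v in F, are essentially exhausted by a sequence
    of them on each piece of finite measure; the functions so selected, over all
    q and all pieces, have the essential supremum of F as pointwise supremum. *)
Lemma measurable_ess_sup (F : set (X -> \bar R)) :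
  F !=set0 -> (forall u, F u -> measurable_fun [set: X] u) ->
  exists2 u : nat -> X -> \bar R, (forall n, F (u n)) &
    forall v, F v -> {ae mu, forall x, v x <= ereal_sup (range (u ^~ x))}.
Proof.
move=> [f0 Ff0] Fm.
have [E [EE _ mE]] := (sigma_finiteP _ _).1 (sigma_finiteT mu).
pose L (q : rat) (v : X -> \bar R) := [set x | (ratr q)%:E < v x].
have wP (k : rat * nat) : {w : nat -> X -> \bar R | (forall n, F (w n)) /\
    forall v, F v -> mu (E k.2 `&` (L k.1 v `\` \bigcup_n L k.1 (w n))) = 0}.
  apply/cid.
  have [mEk Ekfin] := mE k.2.
  have [||B [FB BP]] := essential_union (A := [set L k.1 v | v in F]) mEk Ekfin.
  - by exists (L k.1 f0), f0.
  - move=> _ [v Fv <-].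
    rewrite -[L _ _]setTI; apply: emeasurable_fun_o_infty => //; exact: Fm.
  have {}FB n : {w | F w /\ L k.1 w = B n}.
    by apply/cid; have [w Fw wB] := FB n; exists w.
  exists (fun n => sval (FB n)); split=> [n|v Fv].
    by have [] := svalP (FB n).
  rewrite (_ : \bigcup_n _ = \bigcup_n B n); first by apply: BP; exists v.
  by apply: eq_bigcup => // n _; have [] := svalP (FB n).
pose u m := if @unpickle ((rat * nat) * nat)%type m is Some kn
  then sval (wP kn.1) kn.2 else f0.
exists u => [m|v Fv].
  rewrite /u; case: unpickle => [[k n]|//] /=.
  by have [] := svalP (wP k).
have mL q w : F w -> measurable (L q w).
  move=> Fw; rewrite -[L _ _]setTI.
  by apply: emeasurable_fun_o_infty => //; exact: Fm.
have : {ae mu, forall x, forall k : rat * nat, [set: rat * nat] k ->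
    ~ (E k.2 `&` (L k.1 v `\` \bigcup_n L k.1 (sval (wP k) n))) x}.
  apply: ae_countable => [|k _]; first exact: countableP.
  have [Fw w0] := svalP (wP k).
  exists (E k.2 `&` (L k.1 v `\` \bigcup_n L k.1 (sval (wP k) n))); split.
  - apply: measurableI; first by have [] := mE k.2.
    apply: measurableD; first exact: mL.
    by apply: bigcupT_measurable => n; exact: mL.
  - exact: w0.
  - by move=> x /= /contrapT.
apply: filterS => x H; rewrite leNgt.
apply/negP => /ereal_lt_rat[q /andP[supq qv]].
have [n _ Enx] : (\bigcup_n E n) x by rewrite -EE.
apply: (H (q, n)) => //; split=> //; split=> //= -[m _].
rewrite /L /=; apply/negP; rewrite -leNgt (le_trans _ supq)//.
apply: ereal_sup_ubound; exists (pickle ((q, n), m)) => //.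
by rewrite /u pickleK.
Qed.

Lemma measurable_sup_seq (u : nat -> X -> \bar R) :
  (forall n, measurable_fun [set: X] (u n)) ->
  measurable_fun [set: X] (fun x => ereal_sup (range (u ^~ x))).
Proof.
move=> mu_; rewrite (_ : (fun x => _) = (fun x => esups (u ^~ x) 0%N)).
  exact: measurable_fun_esups.
apply/funext => x; congr ereal_sup.
by apply/seteqP; split=> y /= [n _ <-]; exists n.
Qed.

(** The lattice supremum is a choice of a function with its defining property;
    this is where sigma-finiteness provides one.  That a sequence in F suffices
    makes it possible to compare it with pointwise suprema. *)
Lemma lattice_supP (F : set (X -> \bar R)) :
  F !=set0 -> (forall u, F u -> ae_measurable mu u) ->
  is_lattice_sup mu F (lattice_sup mu F) /\
  exists2 u : nat -> X -> \bar R, (forall n, F (u n)) &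
    {ae mu, forall x, lattice_sup mu F x <= ereal_sup (range (u ^~ x))}.
Proof.
move=> [f0 Ff0] Fm.
pose F' := [set v | measurable_fun [set: X] v /\
  exists2 u, F u & {ae mu, forall x, u x = v x}].
have [||w F'w wsup] := @measurable_ess_sup F'.
- by have [v mv vE] := Fm _ Ff0; exists v; split=> //; exists f0.
- by move=> v [].
have uP n : {u | F u /\ {ae mu, forall x, u x = w n x}}.
  by apply/cid; have [_ [u Fu uw]] := F'w n; exists u.
pose h x := ereal_sup (range (w ^~ x)).
have mh : measurable_fun [set: X] h.
  by apply: measurable_sup_seq => n; have [] := F'w n.
have hsup : is_lattice_sup mu F h.
  split=> // [u Fu|h' mh' uh'].
    have [v mv uv] := Fm _ Fu.
    have vh : {ae mu, forall x, v x <= h x}.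
      by apply: wsup; split=> //; exists u.
    by apply: filterS2 uv vh => x ->.
  have : {ae mu, forall x, forall n, w n x <= h' x}.
    apply: ae_foralln => n; have [Fu uw] := svalP (uP n).
    by apply: filterS2 uw (uh' _ Fu) => x ->.
  by apply: filterS => x wh; apply: ge_ereal_sup => _ [n _ <-].
have lsup : is_lattice_sup mu F (lattice_sup mu F) by apply: getPex; exists h.
split=> //; exists (fun n => sval (uP n)) => [n|].
  by have [] := svalP (uP n).
have [_ _ /(_ h mh)] := lsup; have [_ hu _] := hsup => /(_ hu) sh.
have uw : {ae mu, forall x, forall n, sval (uP n) x = w n x}.
  by apply: ae_foralln => n; have [] := svalP (uP n).
apply: filterS2 sh uw => x sh uw; apply: (le_trans sh).
rewrite /h (_ : range (w ^~ x) = range ((fun n => sval (uP n)) ^~ x))//.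
by apply/seteqP; split=> y [n _ <-]; exists n; rewrite ?uw.
Qed.

End esssup.

(** * Complex absolute values and operators on L^0 *)

Section cabs_theory.
Local Open Scope ereal_scope.
Context (R : realType).
Implicit Types z w : R[i].

Lemma cabs_ge0 z : 0 <= cabs z.
Proof. by case: z => a b; rewrite lee_fin sqrtr_ge0. Qed.

Lemma cabsD z w : cabs (z + w)%R <= cabs z + cabs w.
Proof. by rewrite -EFinD lee_fin; exact: le_normcD. Qed.

Lemma cabs_real (a : R) : cabs (a%:C)%C = `|a|%:E.
Proof. by rewrite /cabs /= expr0n/= addr0 sqrtr_sqr. Qed.

Lemma cabs_norm z : cabs (`|z|)%R = cabs z.
Proof.
rewrite [X in cabs X](_ : _ = ((ComplexField.Normc.normc z)%:C)%C)//.
by rewrite cabs_real ger0_norm//; have := cabs_ge0 z; rewrite lee_fin.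
Qed.

Lemma cabs0 : cabs (0%R : R[i]) = 0.
Proof. by rewrite (cabs_real 0) normr0. Qed.

End cabs_theory.

Section L0_theory.
Context d (X : measurableType d) (R : realType)
  (mu : {measure set X -> \bar R}).
Implicit Types f g : X -> R[i].

Lemma L0_real (G : X -> R) : measurable_fun [set: X] G ->
  L0 mu (fun x => (G x)%:C%C).
Proof.
move=> mG; exists (fun x => (G x)%:C%C); split => //=.
by apply: filterE.
Qed.

Lemma L0_lin (c : R[i]) f g : L0 mu f -> L0 mu g ->
  L0 mu (fun x => c * f x + g x).
Proof.
move=> [f' [mrf mif ff']] [g' [mrg mig gg']].
exists (fun x => c * f' x + g' x); split.
- rewrite (_ : (fun x => _) = (fun x => complex.Re c * complex.Re (f' x) -
      complex.Im c * complex.Im (f' x) + complex.Re (g' x))); last first.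
    by apply/funext => x; case: c (f' x) (g' x) => [? ?] [? ?] [? ?].
  by apply: measurable_funD => //; apply: measurable_funB;
    apply: measurable_funM.
- rewrite (_ : (fun x => _) = (fun x => complex.Re c * complex.Im (f' x) +
      complex.Im c * complex.Re (f' x) + complex.Im (g' x))); last first.
    by apply/funext => x; case: c (f' x) (g' x) => [? ?] [? ?] [? ?].
  by apply: measurable_funD => //; apply: measurable_funD;
    apply: measurable_funM.
- by apply: filterS2 ff' gg' => x -> ->.
Qed.

Lemma L0_sub f g : L0 mu f -> L0 mu g -> L0 mu (fun x => f x - g x).
Proof.
move=> Lf Lg; have := L0_lin (-1) Lg Lf.
by congr L0; apply/funext => x; rewrite mulN1r addrC.
Qed.

Lemma L0_cabs f : L0 mu f -> ae_measurable mu (fun x => cabs (f x)).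
Proof.
move=> [f' [mr mi ff']]; exists (fun x => cabs (f' x)).
  apply/measurable_EFinP.
  rewrite (_ : (fun x => _) = (@Num.sqrt R) \o
    (fun x => complex.Re (f' x) ^+ 2 + complex.Im (f' x) ^+ 2)); last first.
    by apply/funext => x /=; case: (f' x).
  apply: measurableT_comp.
    by apply: continuous_measurable_fun; exact: sqrt_continuous.
  by apply: measurable_funD; exact: measurable_funX.
by apply: filterS ff' => x ->.
Qed.

Lemma L0_op_sub T f g : L0_operator mu T -> L0 mu f -> L0 mu g ->
  {ae mu, forall x, T (fun y => f y - g y) x = T f x - T g x}.
Proof.
move=> [_ _ lT] Lf Lg; rewrite (_ : (fun y => _) = (fun y => -1 * g y + f y)).
  by apply: filterS (lT (-1) g f Lg Lf) => x ->; rewrite mulN1r addrC.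
by apply/funext => y; rewrite mulN1r addrC.
Qed.

End L0_theory.

(** * Powers and sums of extended reals *)

Section powers.
Local Open Scope ereal_scope.
Context (R : realType).
Implicit Types x y : \bar R.

Lemma lee_poweR (s : R) x y : (0 <= s)%R -> 0 <= x -> x <= y ->
  x `^ s <= y `^ s.
Proof.
move=> s0 x0 xy; apply: gt0_ler_poweR => //; rewrite in_itv/= ?x0 ?leey//.
by rewrite (le_trans x0).
Qed.

Lemma poweRK (s : R) x : s != 0%R -> 0 <= x -> (x `^ s) `^ s^-1 = x.
Proof. by move=> s0 x0; rewrite -poweRrM mulfV// poweRe1. Qed.

Lemma poweRVK (s : R) x : s != 0%R -> 0 <= x -> (x `^ s^-1) `^ s = x.
Proof. by move=> s0 x0; rewrite -poweRrM mulVf// poweRe1. Qed.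

(** Crude quasi-triangle inequality, from x + y <= 2 max(x, y).  It replaces
    Minkowski's inequality throughout, since constants are immaterial. *)
Lemma poweRD_le (s : R) x y : (0 < s)%R -> 0 <= x -> 0 <= y ->
  (x + y) `^ s <= (2 `^ s)%:E * (x `^ s + y `^ s).
Proof.
move=> s0 x0 y0.
have m0 : 0 <= maxe x y by rewrite le_max x0.
have xym : x + y <= 2%:E * maxe x y.
  by rewrite -[2%R]/(1 + 1)%R EFinD ge0_muleDl// mul1e leeD// le_max lexx ?orbT.
apply: (le_trans (lee_poweR (ltW s0) (adde_ge0 x0 y0) xym)).
rewrite poweRM// poweR_EFin lee_wpmul2l// ?lee_fin ?powR_ge0//.
by have /orP[/max_idPr->|/max_idPl->] := le_total x y;
  [rewrite leeDr|rewrite leeDl]; rewrite ?poweR_ge0.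
Qed.

Lemma root_le_pow (p C : R) x y : (0 < p)%R -> (0 <= C)%R -> 0 <= x -> 0 <= y ->
  x `^ p^-1 <= C%:E * y `^ p^-1 -> x <= (C `^ p)%:E * y.
Proof.
move=> p0 C0 x0 y0 xy; have pn0 : p != 0%R by rewrite gt_eqF.
have := lee_poweR (ltW p0) (poweR_ge0 _ _) xy.
by rewrite poweRVK// poweRM ?poweR_ge0 ?lee_fin// poweRVK// poweR_EFin.
Qed.

Lemma pow_le_root (p C : R) x y : (0 < p)%R -> (0 <= C)%R -> 0 <= x -> 0 <= y ->
  x <= C%:E * y -> x `^ p^-1 <= (C `^ p^-1)%:E * y `^ p^-1.
Proof.
move=> p0 C0 x0 y0 xy.
have := lee_poweR _ x0 xy => /(_ p^-1%R); rewrite invr_ge0 => /(_ (ltW p0)).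
by rewrite poweRM ?lee_fin// poweR_EFin.
Qed.

Lemma esum_Posz (a : int -> \bar R) J : (forall j, 0 <= a j) ->
  \esum_(j in [set Posz n | n in `I_J]) a j = \sum_(n < J) a n.
Proof.
move=> a0; rewrite esum_image//; last by move=> m n _ _ [].
by rewrite esum_fset// -fsbig_ord.
Qed.

Lemma esum_int_ge (a : int -> \bar R) J : (forall j, 0 <= a j) ->
  \sum_(n < J) a n <= \esum_(j in [set: int]) a j.
Proof.
move=> a0; rewrite -esum_Posz// esum_mkcond le_esum// => j _.
by case: ifP.
Qed.

Lemma esum_int_support (a : int -> \bar R) J : (forall j, 0 <= a j) ->
  (forall j : int, (forall n : nat, (n < J)%N -> j <> n) -> a j = 0) ->
  \esum_(j in [set: int]) a j = \sum_(n < J) a n.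
Proof.
move=> a0 aS; rewrite -esum_Posz// [RHS]esum_mkcond; apply: eq_esum => j _.
case: ifPn => //; rewrite notin_setE /= => jS; apply: aS => n nJ jn.
by apply: jS; exists n.
Qed.

End powers.

(** * Energy and majorants *)

Section energy.
Local Open Scope ereal_scope.
Context d (X : measurableType d) (R : realType)
  (mu : {measure set X -> \bar R}).
Context (p r : R) (p0 : (0 < p)%R) (r0 : (0 < r)%R).

(** The p-th power of the L^p(l^r) norm of the first J functions.  Without the
    outer root, all bounds become linear in this quantity. *)
Definition energy J (H : nat -> X -> \bar R) : \bar R :=
  \int[mu]_x (\sum_(j < J) H j x `^ r) `^ (p / r).

Let rn0 : r != 0%R. Proof. by rewrite gt_eqF. Qed.
Let pr0 : (0 < p / r)%R. Proof. by rewrite divr_gt0. Qed.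

Lemma energy_ge0 J H : 0 <= energy J H.
Proof. by apply: integral_ge0 => x _; exact: poweR_ge0. Qed.

Lemma le_energy J H H' : (forall j x, 0 <= H j x) ->
  {ae mu, forall x, forall j, (j < J)%N -> H j x <= H' j x} ->
  energy J H <= energy J H'.
Proof.
move=> H0 HH'; apply: ae_le_lower_integral => [x|x|]; rewrite ?poweR_ge0//.
apply: filterS HH' => x HH'; apply: lee_poweR; first exact: ltW.
  by apply: sume_ge0 => j _; exact: poweR_ge0.
by apply: lee_sum => j _; apply: lee_poweR; [exact: ltW| |exact: HH'].
Qed.

Lemma measurable_energy_density J (H : nat -> X -> \bar R) :
  (forall j, measurable_fun [set: X] (H j)) ->
  measurable_fun [set: X] (fun x => (\sum_(j < J) H j x `^ r) `^ (p / r)).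
Proof.
move=> mH; apply: (measurableT_comp (measurable_poweR _)).
by apply: emeasurable_sum => j; exact: (measurableT_comp (measurable_poweR _)).
Qed.

(** The constant is (2^r)^(p/r) = 2^p from the powers r, times 2^(p/r) from the
    outer power. *)
Lemma energyD J (H H' : nat -> X -> \bar R) :
  (forall j x, 0 <= H j x) -> (forall j x, 0 <= H' j x) ->
  (forall j, measurable_fun [set: X] (H j)) ->
  (forall j, measurable_fun [set: X] (H' j)) ->
  energy J (fun j x => H j x + H' j x) <=
  (2 `^ p * 2 `^ (p / r))%:E * (energy J H + energy J H').
Proof.
move=> H0 H'0 mH mH'.
have mE := measurable_energy_density J mH.
have mE' := measurable_energy_density J mH'.
rewrite -ge0_integralD//; try by move=> *; exact: poweR_ge0.
rewrite -ge0_integralZl//; last 2 first.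
- exact: emeasurable_funD.
- by move=> x _; rewrite adde_ge0 ?poweR_ge0.
apply: ae_le_lower_integral => [x|x|]; rewrite ?poweR_ge0//.
  by apply: mule_ge0; rewrite ?lee_fin ?mulr_ge0 ?powR_ge0 ?adde_ge0 ?poweR_ge0.
apply: filterE => x.
set a := \sum_(j < J) H j x `^ r; set b := \sum_(j < J) H' j x `^ r.
have a0 : 0 <= a by apply: sume_ge0 => j _; exact: poweR_ge0.
have b0 : 0 <= b by apply: sume_ge0 => j _; exact: poweR_ge0.
apply: (@le_trans _ _ (((2 `^ r)%:E * (a + b)) `^ (p / r))).
  apply: lee_poweR; first exact: ltW.
    by apply: sume_ge0 => j _; exact: poweR_ge0.
  rewrite /a /b -big_split/= ge0_sume_distrr; last first.
    by move=> j _; rewrite adde_ge0 ?poweR_ge0.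
  by apply: lee_sum => j _; exact: poweRD_le.
rewrite poweRM ?adde_ge0 ?lee_fin ?powR_ge0// poweR_EFin -powRrM.
rewrite (mulrC r) divfK// EFinM -muleA lee_wpmul2l ?lee_fin ?powR_ge0//.
exact: poweRD_le.
Qed.

Lemma Lp_lr_normE (u : int -> X -> \bar R) :
  Lp_lr_norm mu p r u =
  (\int[mu]_x (\esum_(j in [set: int]) (`|u j x| `^ r)) `^ (p / r)) `^ p^-1.
Proof.
rewrite /Lp_lr_norm unlock; congr (_ `^ _); apply: eq_integral => x _.
by rewrite gee0_abs ?poweR_ge0// -poweRrM mulrC.
Qed.

Lemma energy_lt_pinfty_ae J (H : nat -> X -> \bar R) :
  (forall j x, 0 <= H j x) -> (forall j, measurable_fun [set: X] (H j)) ->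
  energy J H < +oo ->
  {ae mu, forall x, forall j, (j < J)%N -> H j x \is a fin_num}.
Proof.
move=> H0 mH Hfin.
have /(integrable_ae measurableT) : mu.-integrable [set: X]
    (fun x => (\sum_(j < J) H j x `^ r) `^ (p / r)).
  apply/integrableP; split; first exact: measurable_energy_density.
  apply: le_lt_trans Hfin; apply: ae_le_lower_integral.
  - by [].
  - by move=> x; exact: poweR_ge0.
  - by apply: filterE => x; rewrite gee0_abs ?poweR_ge0.
apply: filterS => x /(_ I) Efin j jJ; rewrite ge0_fin_numE//.
apply: (lty_poweRy rn0).
have : \sum_(j < J) H j x `^ r < +oo.
  apply: (@lty_poweRy _ _ (p / r)); first by rewrite gt_eqF.
  by rewrite ltey_eq Efin.
apply: le_lt_trans; rewrite (bigD1 (Ordinal jJ))//= leeDl//.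
by apply: sume_ge0 => i _; exact: poweR_ge0.
Qed.

(** Majorants are kept real-valued: they have to be inserted again, as elements
    of L^0, into the next maximal operator. *)
Definition weight (G : nat -> X -> R) :=
  (forall j, measurable_fun [set: X] (G j)) /\ (forall j x, (0 <= G j x)%R).

Definition wenergy J (G : nat -> X -> R) := energy J (fun j x => (G j x)%:E).

Lemma wenergyD J G G' : weight G -> weight G' ->
  weight (fun j x => G j x + G' j x)%R /\
  wenergy J (fun j x => G j x + G' j x)%R <=
    (2 `^ p * 2 `^ (p / r))%:E * (wenergy J G + wenergy J G').
Proof.
move=> [mG G0] [mG' G'0]; split.
  by split=> [j|j x]; [exact: measurable_funD|exact: addr_ge0].
rewrite /wenergy.
under [X in energy J X]eq_fun do under eq_fun do rewrite EFinD.
by apply: energyD => *; rewrite ?lee_fin//; exact/measurable_EFinP.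
Qed.

(** Finite energy makes an extended real family finite almost everywhere, so
    that it can be replaced by a real majorant of no larger energy. *)
Lemma weight_of_energy J (H : nat -> X -> \bar R) :
  (forall j, measurable_fun [set: X] (H j)) ->
  energy J (fun j x => `|H j x|) < +oo ->
  exists G, [/\ weight G, wenergy J G <= energy J (fun j x => `|H j x|) &
    {ae mu, forall x, forall j, (j < J)%N -> H j x <= (G j x)%:E}].
Proof.
move=> mH Hfin.
have mH' j : measurable_fun [set: X] (fun x => `|H j x|).
  exact: measurableT_comp.
have fin_ae := energy_lt_pinfty_ae (fun j x => abse_ge0 (H j x)) mH' Hfin.
exists (fun j x => fine `|H j x|); split.
- split=> [j|j x]; last by rewrite fine_ge0.
  exact: (measurableT_comp (fine_measurable measurableT)).
- apply: le_energy => [j x|]; first by rewrite lee_fin fine_ge0.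
  by apply: filterE => x j _; case: (H j x) => [z||] /=; rewrite ?lexx ?leey.
- apply: filterS fin_ae => x Hx j jJ.
  by rewrite fineK ?Hx// lee_abs.
Qed.

End energy.

(** * The maximal inequality for majorants *)

Section maximal.
Local Open Scope ereal_scope.
Context d (X : measurableType d) (R : realType)
  (mu : {sigma_finite_measure set X -> \bar R}).
Implicit Types f g : X -> R[i].

Lemma abs_opP (T : (X -> R[i]) -> (X -> R[i])) f :
  L0_operator mu T -> L0 mu f ->
  measurable_fun [set: X] (abs_op mu T f) /\
  forall g, L0 mu g -> {ae mu, forall x, cabs (g x) <= cabs (f x)} ->
    {ae mu, forall x, cabs (T g x) <= abs_op mu T f x}.
Proof.
move=> LT Lf.
have [||[mT uT _] _] := @lattice_supP _ _ _ mu [set (fun x => cabs (T g x)) |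
    g in [set g | L0 mu g /\ {ae mu, forall x, (cabs (g x) <= cabs (f x))}]].
- by exists (fun x => cabs (T f x)), f => //; split=> //; exact: filterE.
- by move=> _ [g [Lg _] <-]; apply: L0_cabs; exact: (L0_op_stable LT).
by split=> // g Lg gf; apply: uT; exists g.
Qed.

(** The only property of the maximal operator that the proof uses: it majorizes
    every T_t g with |g| <= |f|. *)
Lemma max_opP (I : set R) (T : R -> (X -> R[i]) -> (X -> R[i])) f :
  I !=set0 -> (forall t, I t -> L0_operator mu (T t)) -> L0 mu f ->
  measurable_fun [set: X] (max_op mu I T f) /\
  forall t g, I t -> L0 mu g -> {ae mu, forall x, cabs (g x) <= cabs (f x)} ->
    {ae mu, forall x, cabs (T t g x) <= max_op mu I T f x}.
Proof.
move=> [t0 It0] LT Lf.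
have [||[mT uT _] _] := @lattice_supP _ _ _ mu [set abs_op mu (T t) f | t in I].
- by exists (abs_op mu (T t0) f), t0.
- move=> _ [t It <-]; have [mt _] := abs_opP (LT t It) Lf.
  by exists (abs_op mu (T t) f) => //; exact: filterE.
split=> // t g It Lg gf; have [_ /(_ _ Lg gf)] := abs_opP (LT t It) Lf.
by apply: filterS2 (uT _ _) => [x h1 h2|]; [exact: le_trans h2 h1|exists t].
Qed.

Context (p r : R) (p0 : (0 < p)%R) (r0 : (0 < r)%R).

Definition zero_ext J (G : nat -> X -> R) (j : int) : X -> R[i] :=
  if j is Posz n then if (n < J)%N then fun x => ((G n x)%:C)%C else fun=> 0%R
  else fun=> 0%R.

Lemma Lp_lr_norm_zero_ext J G : weight G ->
  Lp_lr_norm mu p r (fun j x => cabs (zero_ext J G j x)) =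
  (wenergy mu p r J G) `^ p^-1.
Proof.
move=> [mG G0]; rewrite Lp_lr_normE; congr (_ `^ _).
apply: eq_integral => x _; congr (_ `^ _).
rewrite (@esum_int_support _ _ J); last 2 first.
- by move=> j; exact: poweR_ge0.
- move=> [n|n] H; rewrite /zero_ext; last first.
    by rewrite cabs0 abse0 poweR0r// gt_eqF.
  case: ifPn => nJ; first by case: (H n).
  by rewrite cabs0 abse0 poweR0r// gt_eqF.
apply: eq_bigr => n _; rewrite /zero_ext ltn_ord gee0_abs ?cabs_ge0// cabs_real.
by rewrite ger0_norm.
Qed.

Lemma energy_le_Lp_lr_norm J (u : int -> X -> \bar R) :
  energy mu p r J (fun n x => `|u n x|) <=
  \int[mu]_x (\esum_(j in [set: int]) (`|u j x| `^ r)) `^ (p / r).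
Proof.
apply: ae_le_lower_integral => [x|x|]; rewrite ?poweR_ge0//.
apply: filterE => x; apply: lee_poweR.
- by rewrite divr_ge0// ltW.
- by apply: sume_ge0 => j _; exact: poweR_ge0.
by apply: (@esum_int_ge _ (fun j => `|u j x| `^ r)) => j; exact: poweR_ge0.
Qed.

(** The vector-valued maximal inequality, read as a statement on majorants: a
    majorant G of a finite family of functions produces a majorant of the images
    of this family under all operators T_t at once, at the cost of a constant
    factor in the energy. *)
Lemma maximal_step (I : set R) (T : R -> (X -> R[i]) -> (X -> R[i])) :
  I !=set0 -> (forall t, I t -> L0_operator mu (T t)) ->
  vector_valued_max_bound mu p r I T ->
  exists2 c : R, (0 < c)%R & forall J G, weight G -> wenergy mu p r J G < +oo ->
  exists G', [/\ weight G',
    wenergy mu p r J G' <= c%:E * wenergy mu p r J G &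
    forall j t g, (j < J)%N -> I t -> L0 mu g ->
      {ae mu, forall x, cabs (g x) <= (G j x)%:E} ->
      {ae mu, forall x, cabs (T t g x) <= (G' j x)%:E}].
Proof.
move=> I0 LT [C [C0 HC]]; exists (C `^ p)%R; first exact: powR_gt0.
move=> J G wG Gfin.
have [mG G0] := wG.
pose f := zero_ext J G.
have Lf j : L0 mu (f j).
  rewrite /f /zero_ext; case: j => n.
    by case: ifP => _; apply: L0_real.
  exact: (L0_real _ (measurable_cst _)).
have cf j x : cabs (`|f j x|)%R = cabs (f j x) by exact: cabs_norm.
have Lnf j : L0 mu (fun x => `|f j x|)%R.
  rewrite (_ : (fun x => _) = f j)//; apply/funext => x.
  rewrite [LHS](_ : _ = ((ComplexField.Normc.normc (f j x))%:C)%C)//.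
  have [a a0 ->] : exists2 a : R, (0 <= a)%R & f j x = (a%:C)%C.
    rewrite /f /zero_ext; case: j => n; last by exists 0%R.
    by case: ifP => _; [exists (G n x)|exists 0%R].
  congr (_%:C)%C; apply: EFin_inj.
  by rewrite -[LHS]/(cabs _) cabs_real ger0_norm.
pose H (n : nat) := max_op mu I T (fun x => `|f n x|)%R.
have mH n : measurable_fun [set: X] (H n) by have [] := max_opP I0 LT (Lnf n).
have HG : energy mu p r J (fun n x => `|H n x|) <=
    (C `^ p)%:E * wenergy mu p r J G.
  apply: (le_trans (energy_le_Lp_lr_norm J
    (fun j => max_op mu I T (fun x => `|f j x|)%R))).
  apply: root_le_pow => //; first exact: ltW.
  - by apply: integral_ge0 => x _; exact: poweR_ge0.
  - exact: energy_ge0.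
  rewrite -Lp_lr_normE -Lp_lr_norm_zero_ext//; apply: HC => //.
  by rewrite Lp_lr_norm_zero_ext// poweR_lty.
have Hfin : energy mu p r J (fun n x => `|H n x|) < +oo.
  by apply: (le_lt_trans HG); rewrite lte_mul_pinfty// ?lee_fin ?powR_ge0.
have [G' [wG' eG' HG']] := weight_of_energy p0 r0 mH Hfin.
exists G'; split=> // [|j t g jJ It Lg gG]; first exact: (le_trans eG').
have gf : {ae mu, forall x, cabs (g x) <= cabs (`|f j x|)%R}.
  apply: filterS gG => x; rewrite cf /f /zero_ext jJ cabs_real.
  by rewrite ger0_norm.
have [_ /(_ t g It Lg gf)] := max_opP I0 LT (Lnf j).
by apply: filterS2 HG' => x /(_ j jJ) HG' gH; exact: le_trans gH HG'.
Qed.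

End maximal.

(** * The one-parameter oscillation inequality for majorants *)

Section one_parameter.
Local Open Scope ereal_scope.
Context d (X : measurableType d) (R : realType)
  (mu : {sigma_finite_measure set X -> \bar R}).
Context (p r : R) (p0 : (0 < p)%R) (r0 : (0 < r)%R).
Implicit Types f g : X -> R[i].

Let rn0 : r != 0%R. Proof. by rewrite gt_eqF. Qed.

Lemma Lnorm_oscillation m (A : set 'rV[R]_m) t J (a : 'rV[R]_m -> X -> R[i]) :
  'N[mu]_p%:E[oscillation r A t J a] =
  (\int[mu]_x (\sum_(j < J) ereal_sup [set cabs (a s x - a (t j) x)%R `^ r |
      s in box (t j) (t j.+1) `&` A]) `^ (p / r)) `^ p^-1.
Proof.
rewrite unlock; congr (_ `^ _); apply: eq_integral => x _.
by rewrite gee0_abs ?poweR_ge0// -poweRrM mulrC.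
Qed.

Lemma L0_op_diff_ae_measurable S T f : L0_operator mu S -> L0_operator mu T ->
  L0 mu f -> ae_measurable mu (fun x => cabs (S f x - T f x)%R).
Proof.
move=> LS LT Lf; apply: L0_cabs.
by apply: L0_sub; [exact: (L0_op_stable LS)|exact: (L0_op_stable LT)].
Qed.

(** The one-parameter oscillation hypothesis speaks about representatives that
    are continuous in the parameter, or about countable index sets. *)
Lemma one_parameter_version (I : set R)
    (T : R -> (X -> R[i]) -> (X -> R[i])) f :
  L0 mu f ->
  (~ countable I -> forall f, L0 mu f ->
      exists2 a : R -> X -> R[i],
        is_version mu I (fun t => T t f) a & ae_continuous mu I a) ->
  exists2 b : R -> X -> R[i], is_version mu I (fun t => T t f) b &
    countable (@set_pow R I 1) \/
    ae_continuous mu (@set_pow R I 1) (fun t => b (t ord0 ord0)).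
Proof.
move=> Lf Tcont; have [cI|/Tcont/(_ f Lf)[b vb cb]] := pselect (countable I).
  exists (fun t => T t f) => [t _|]; first exact: filterE.
  left; apply: (@sub_countable _ _ _
    ((fun s : R => const_mx s : 'rV[R]_1) @` I)).
    apply: subset_card_le => t It; exists (t ord0 ord0) => //.
    by apply/rowP => i; rewrite mxE (ord1 i).
  exact: sub_countable (card_image_le _ _) cI.
exists b => //; right; apply: filterS cb => x [cr ci].
have coord (h : R -> R) : {within I, continuous h} ->
    {within @set_pow R I 1, continuous (fun t : 'rV[R]_1 => h (t ord0 ord0))}.
  move=> /subspace_continuousP ch; apply/subspace_continuousP => t It.
  have Itt : I (t ord0 ord0) by exact: It.
  have := ch _ Itt; rewrite /from_subspace /= => cht.
  move=> B /cht hB; have hc := @coord_continuous R 1 1 ord0 ord0 t _ hB.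
  change (nbhs t (fun s : 'rV[R]_1 => set_pow I s -> B (h (s ord0 ord0)))).
  by apply: (@filterS _ (nbhs t) _ _ _ _ hc) => s hs Is; apply: hs; exact: Is.
by split; [exact: coord cr|exact: coord ci].
Qed.

(** The one-parameter oscillation inequality in terms of majorants: the lattice
    supremum over s in [tau_j, tau_(j+1)) of |T_s f - T_(tau_j) f| is attained
    by a sequence, hence almost everywhere at most the pointwise supremum in
    the oscillation of any version. *)
Lemma oscillation_step (I : set R) (T : R -> (X -> R[i]) -> (X -> R[i])) :
  (forall t, I t -> L0_operator mu (T t)) ->
  (~ countable I -> forall f, L0 mu f ->
      exists2 a : R -> X -> R[i],
        is_version mu I (fun t => T t f) a & ae_continuous mu I a) ->
  oscillation_bound mu p r (@set_pow R I 1)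
      (fun t : 'rV[R]_1 => T (t ord0 ord0)) ->
  exists2 c : R, (0 < c)%R & forall f J (tau : nat -> R),
    Lp mu p f -> (0 < J)%N ->
    (forall j, (j <= J)%N -> I (tau j)) ->
    (forall j, (j < J)%N -> (tau j < tau j.+1)%R) ->
  exists G, [/\ weight G,
    wenergy mu p r J G <= c%:E * Lp_norm mu p f `^ p &
    forall j s, (j < J)%N -> I s -> (tau j <= s < tau j.+1)%R ->
      {ae mu, forall x, cabs (T s f x - T (tau j) f x)%R <= (G j x)%:E}].
Proof.
move=> LT Tcont [C [C0 HC]]; exists (C `^ p)%R; first exact: powR_gt0.
move=> f J tau Lpf J0 Itau tau_lt; have [Lf ffin] := Lpf.
have [b vb cb] := one_parameter_version Lf Tcont.
pose F j : set (X -> \bar R) :=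
  [set (fun x => cabs (T s f x - T (tau j) f x)%R) |
  s in [set s | I s /\ (tau j <= s < tau j.+1)%R]].
have FP j : (j < J)%N -> F j !=set0 /\ forall u, F j u -> ae_measurable mu u.
  move=> jJ; have Ij := Itau _ (ltnW jJ); split.
    exists (fun x => cabs (T (tau j) f x - T (tau j) f x)%R), (tau j) => //=.
    by rewrite lexx tau_lt.
  move=> _ [s [Is _] <-].
  by apply: L0_op_diff_ae_measurable; [exact: LT|exact: LT|].
have sup j (jJ : (j < J)%N) := lattice_supP (FP j jJ).1 (FP j jJ).2.
(* Beyond J the interval may be empty; zero keeps the family measurable. *)
pose H j x : \bar R := if (j < J)%N then lattice_sup mu (F j) x else 0.
have mH j : measurable_fun [set: X] (H j).
  rewrite /H; case: (ltnP j J) => [jJ|_]; last exact: measurable_cst.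
  by have [[mS _ _] _] := sup j jJ.
pose t j : 'rV[R]_1 := const_mx (tau j).
pose S x j := ereal_sup
  [set cabs (b (s ord0 ord0) x - b (t j ord0 ord0) x)%R `^ r |
    s in box (t j) (t j.+1) `&` @set_pow R I 1].
have HS : {ae mu, forall x, forall j, (j < J)%N -> `|H j x| `^ r <= S x j}.
  apply: ae_foralln => j; case: (ltnP j J) => [jJ|_]; last exact: filterE.
  have Ij := Itau _ (ltnW jJ).
  have [[_ Hub _] [u Fu Hu]] := sup j jJ.
  have nP n : {s | (I s /\ (tau j <= s < tau j.+1)%R) /\
      (fun x => cabs (T s f x - T (tau j) f x)%R) = u n}.
    by apply/cid; have [s sP su] := Fu n; exists s.
  have bT : {ae mu, forall x, forall n,
      b (sval (nP n)) x = T (sval (nP n)) f x}.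
    by apply: ae_foralln => n; have [[Is _] _] := svalP (nP n); exact: vb.
  have H0 : {ae mu, forall x, 0 <= lattice_sup mu (F j) x}.
    apply: filterS (Hub _ (Fu 0%N)) => x; apply: le_trans.
    by have [_ <-] := svalP (nP 0%N); exact: cabs_ge0.
  near=> x => _; rewrite /H jJ gee0_abs; last by near: x.
  have Sub s : I s -> (tau j <= s < tau j.+1)%R ->
      cabs (b s x - b (tau j) x)%R `^ r <= S x j.
    move=> Is sj; apply: ereal_sup_ubound; exists (const_mx s) => /=.
      by split=> i; rewrite !mxE.
    by rewrite !mxE.
  have S0 : 0 <= S x j.
    by apply: le_trans (Sub _ Ij _); rewrite ?poweR_ge0// lexx tau_lt.
  (* Taking roots avoids moving the power through the supremum. *)
  rewrite -[leRHS](poweRVK rn0)//; apply: lee_poweR; first exact: ltW.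
    by near: x.
  apply: (@le_trans _ _ (ereal_sup (range (u ^~ x)))); first by near: x.
  apply: ge_ereal_sup => _ [n _ <-].
  have [[Is sj] <-] := svalP (nP n).
  have <- : b (sval (nP n)) x = T (sval (nP n)) f x by move: n {Is sj}; near: x.
  have <- : b (tau j) x = T (tau j) f x by near: x; exact: vb.
  rewrite -[leLHS](poweRK rn0) ?cabs_ge0//.
  apply: lee_poweR; rewrite ?poweR_ge0//.
    by rewrite invr_ge0 ltW.
  exact: Sub.
have NC : (\int[mu]_x (\sum_(j < J) S x j) `^ (p / r)) `^ p^-1 <=
    C%:E * Lp_norm mu p f.
  have := HC _ Lpf (fun s => b (s ord0 ord0)) (fun s Is => vb _ (Is ord0)) cb.
  apply: le_trans; rewrite -(Lnorm_oscillation _ t).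
  apply: ereal_sup_ge; eexists; first by exists J.
  apply: ereal_sup_ubound; exists t => //.
  split=> [j jJ i|j jJ i]; rewrite !mxE.
    exact: Itau.
  exact: tau_lt.
have eH : energy mu p r J (fun j x => `|H j x|) <=
    (C `^ p)%:E * Lp_norm mu p f `^ p.
  apply: (@le_trans _ _ (\int[mu]_x (\sum_(j < J) S x j) `^ (p / r))).
    apply: ae_le_lower_integral => [x|x|]; rewrite ?poweR_ge0//.
    apply: filterS HS => x HS; apply: lee_poweR.
    - by rewrite divr_ge0// ltW.
    - by apply: sume_ge0 => j _; exact: poweR_ge0.
    - by apply: lee_sum => j _; exact: HS.
  apply: root_le_pow => //; first exact: ltW.
  - by apply: integral_ge0 => x _; exact: poweR_ge0.
  - exact: poweR_ge0.
  - by rewrite poweRK ?gt_eqF// Lnorm_ge0.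
have Hfin : energy mu p r J (fun n x => `|H n x|) < +oo.
  apply: (le_lt_trans eH).
  by rewrite lte_mul_pinfty ?poweR_lty// ?lee_fin ?powR_ge0.
have [G [wG eG HG]] := weight_of_energy p0 r0 mH Hfin.
exists G; split=> // [|j s jJ Is sj]; first exact: (le_trans eG).
have [[_ Hub _] _] := sup j jJ.
apply: filterS2 HG
  (Hub (fun x => cabs (T s f x - T (tau j) f x)%R) _) => [x|]; last first.
  by exists s.
by move=> /(_ j jJ); rewrite /H jJ => h1 h2; exact: le_trans h2 h1.
Unshelve. all: by end_near. Qed.

End one_parameter.

(** * Products of commuting operators *)

Section product.
Local Open Scope ereal_scope.
Context d (X : measurableType d) (R : realType)
  (mu : {sigma_finite_measure set X -> \bar R}).
Context (p r : R) (p0 : (0 < p)%R) (r0 : (0 < r)%R).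
Implicit Types f g : X -> R[i].

Lemma L0_operator_id : L0_operator mu id.
Proof. by split => // *; exact: filterE. Qed.

Lemma L0_operator_comp S T : L0_operator mu S -> L0_operator mu T ->
  L0_operator mu (S \o T).
Proof.
move=> [stS coS liS] [stT coT liT]; split.
- by move=> f /stT/stS.
- by move=> f g Lf Lg fg; apply: coS; [exact: stT|exact: stT|exact: coT].
- move=> c f g Lf Lg.
  have LTf := stT _ Lf; have LTg := stT _ Lg.
  apply: filterS2 (liS c _ _ LTf LTg)
    (coS _ _ (stT _ (L0_lin c Lf Lg)) (L0_lin c LTf LTg) (liT c _ _ Lf Lg)).
  by move=> x /= <- <-.
Qed.

Context (I : set R) (k : nat) (T : 'I_k -> R -> (X -> R[i]) -> (X -> R[i]))
  (I0 : I !=set0)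
  (T_operator : forall i t, I t -> L0_operator mu (T i t))
  (T_commute : forall i j s t, I s -> I t -> L0_commute mu (T i s) (T j t))
  (T_continuous : ~ countable I -> forall i f, L0 mu f ->
    exists2 a : R -> X -> R[i],
      is_version mu I (fun t => T i t f) a & ae_continuous mu I a)
  (T_oscillation : forall i, oscillation_bound mu p r (@set_pow R I 1)
    (fun t : 'rV[R]_1 => T i (t ord0 ord0)))
  (T_maximal : forall i, vector_valued_max_bound mu p r I (T i)).

(** Products along an arbitrary list of indices, so that an induction can remove
    the first factor. *)
Definition list_op (s : seq 'I_k) (t : 'rV[R]_k) : (X -> R[i]) -> (X -> R[i]) :=
  foldr (fun i S => T i (t ord0 i) \o S) id s.

Lemma product_opE t : product_op T t = list_op (index_enum 'I_k) t.
Proof. by rewrite /product_op unlock. Qed.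

Lemma list_op_operator s t : set_pow I t -> L0_operator mu (list_op s t).
Proof.
move=> It; elim: s => [|i s IHs]; first exact: L0_operator_id.
by apply: L0_operator_comp => //; exact: T_operator.
Qed.

Lemma list_op_commute l s t f q : I q -> set_pow I t -> L0 mu f ->
  {ae mu, forall x, T l q (list_op s t f) x = list_op s t (T l q f) x}.
Proof.
move=> Iq It Lf; elim: s => [|i s IHs]; first exact: filterE.
have Ls := list_op_operator s It.
have Lsf := L0_op_stable Ls Lf.
have LTf := L0_op_stable (T_operator l Iq) Lf.
apply: filterS2 (T_commute l i Iq (It i) Lsf)
  (L0_op_congr (T_operator i (It i)) (L0_op_stable (T_operator l Iq) Lsf)
     (L0_op_stable Ls LTf) IHs).
by move=> x /= -> ->.
Qed.

Lemma list_op_maximal s : exists2 c : R, (0 < c)%R &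
  forall J G, weight G -> wenergy mu p r J G < +oo ->
  exists G', [/\ weight G',
    wenergy mu p r J G' <= c%:E * wenergy mu p r J G &
    forall j t g, (j < J)%N -> set_pow I t -> L0 mu g ->
      {ae mu, forall x, cabs (g x) <= (G j x)%:E} ->
      {ae mu, forall x, cabs (list_op s t g x) <= (G' j x)%:E}].
Proof.
elim: s => [|i s [c c0 IHs]].
  by exists 1%R => // J G wG Gfin; exists G; split => //; rewrite mul1e.
have [c' c'0 Hi] := maximal_step p0 r0 I0 (T_operator i) (T_maximal i).
exists (c' * c)%R => [|J G wG Gfin]; first exact: mulr_gt0.
have [G1 [wG1 eG1 dG1]] := IHs J G wG Gfin.
have [|G2 [wG2 eG2 dG2]] := Hi J G1 wG1.
  by apply: (le_lt_trans eG1); rewrite lte_mul_pinfty// lee_fin ltW.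
exists G2; split => // [|j t g jJ It Lg gG].
  by rewrite (le_trans eG2)// EFinM -muleA lee_wpmul2l// lee_fin ltW.
apply: dG2 => //; last exact: dG1.
exact: (L0_op_stable (list_op_operator s It)).
Qed.

(** The heart of the proof.  With C_t the product along s, u = tau_j, and t in
    the box at u, commutation gives
    T_(t_l) C_t f - T_(u_l) C_u f
      = T_(t_l) (C_t f - C_u f) + C_u (T_(t_l) f - T_(u_l) f).
    In the first term the induction hypothesis majorizes the bracket and the
    maximal inequality of T_l the whole; in the second the oscillation
    inequality of T_l majorizes the bracket and the maximal inequalities along s
    the whole. *)
Lemma list_op_oscillation s : exists2 c : R, (0 < c)%R &
  forall f J (tau : nat -> 'rV[R]_k), Lp mu p f -> (0 < J)%N ->
    increasing_seqs (@set_pow R I k) J tau ->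
  exists G, [/\ weight G,
    wenergy mu p r J G <= c%:E * Lp_norm mu p f `^ p &
    forall j t, (j < J)%N -> set_pow I t -> box (tau j) (tau j.+1) t ->
      {ae mu, forall x,
        cabs (list_op s t f x - list_op s (tau j) f x)%R <= (G j x)%:E}].
Proof.
elim: s => [|l s [cs cs0 IHs]].
  exists 1%R => // f J tau Lpf J0 tauP; exists (fun _ _ => 0%R); split => //.
  - rewrite /wenergy /energy integral0_eq ?mul1e ?poweR_ge0// => x _.
    by rewrite big1 ?poweR0r ?gt_eqF ?divr_gt0// => j _;
      rewrite poweR0r ?gt_eqF.
  - by move=> j t *; apply: filterE => x; rewrite subrr cabs0.
have [co co0 Ho] := oscillation_step p0 r0 (T_operator l)
  (fun cI => T_continuous cI l) (T_oscillation l).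
have [cm cm0 Hm] := list_op_maximal s.
have [cl cl0 Hl] := maximal_step p0 r0 I0 (T_operator l) (T_maximal l).
exists ((2 `^ p * 2 `^ (p / r)) * (cl * cs + cm * co))%R.
  by rewrite mulr_gt0 ?addr_gt0 ?mulr_gt0 ?powR_gt0.
move=> f J tau Lpf J0 [tauI tau_lt]; have [Lf ffin] := Lpf.
set N := Lp_norm mu p f `^ p.
have Nfin : N < +oo by rewrite poweR_lty.
have N0 : 0 <= N by exact: poweR_ge0.
have [||G0 [wG0 eG0 dG0]] := Ho f J (fun j => tau j ord0 l) Lpf J0.
- by move=> j jJ; exact: tauI.
- by move=> j jJ; exact: tau_lt.
have [|G1 [wG1 eG1 dG1]] := Hm J G0 wG0.
  by apply: (le_lt_trans eG0); rewrite lte_mul_pinfty// lee_fin ltW.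
have [//|G2 [wG2 eG2 dG2]] := IHs f J tau Lpf J0.
have [|G3 [wG3 eG3 dG3]] := Hl J G2 wG2.
  by apply: (le_lt_trans eG2); rewrite lte_mul_pinfty// lee_fin ltW.
have [wG eG] := wenergyD mu p0 r0 J wG3 wG1.
exists (fun j x => G3 j x + G1 j x)%R; split=> // [|j t jJ It tbox].
  apply: (le_trans eG); rewrite [in leRHS]EFinM -[leRHS]muleA.
  apply: lee_wpmul2l.
    by rewrite lee_fin mulr_ge0 ?powR_ge0.
  rewrite EFinD ge0_muleDl ?lee_fin ?mulr_ge0 ?(ltW cl0) ?(ltW cs0)
    ?(ltW cm0) ?(ltW co0)//.
  rewrite !EFinM -!muleA; apply: leeD.
    by rewrite (le_trans eG3)// lee_wpmul2l ?lee_fin ?(ltW cl0).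
  by rewrite (le_trans eG1)// lee_wpmul2l ?lee_fin ?(ltW cm0).
have Iu : set_pow I (tau j) by exact: tauI (ltnW jJ).
set u := tau j.
have Lt := list_op_operator s It; have Lu := list_op_operator s Iu.
have Ltf := L0_op_stable Lt Lf; have Luf := L0_op_stable Lu Lf.
have Tt := T_operator l (It l); have Tu := T_operator l (Iu l).
have Ttf := L0_op_stable Tt Lf; have Tuf := L0_op_stable Tu Lf.
have B1 := dG3 j (t ord0 l) _ jJ (It l) (L0_sub Ltf Luf) (dG2 j t jJ It tbox).
have B2 := dG1 j u _ jJ Iu (L0_sub Ttf Tuf)
  (dG0 j (t ord0 l) jJ (It l) (tbox l)).
have E1 := L0_op_sub Tt Ltf Luf.
have E2 := list_op_commute l s (It l) Iu Lf.
have E3 := list_op_commute l s (Iu l) Iu Lf.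
have E4 := L0_op_sub Lu Ttf Tuf.
near=> x => /=.
have e1 : T l (t ord0 l) (fun y => list_op s t f y - list_op s u f y)%R x =
  (T l (t ord0 l) (list_op s t f) x - T l (t ord0 l) (list_op s u f) x)%R.
  by near: x.
have e2 : T l (t ord0 l) (list_op s u f) x = list_op s u (T l (t ord0 l) f) x.
  by near: x.
have e3 : T l (u ord0 l) (list_op s u f) x = list_op s u (T l (u ord0 l) f) x.
  by near: x.
have e4 : list_op s u (fun y => T l (t ord0 l) f y - T l (u ord0 l) f y)%R x =
  (list_op s u (T l (t ord0 l) f) x - list_op s u (T l (u ord0 l) f) x)%R.
  by near: x.
rewrite -[X in cabs X](subrKA (T l (t ord0 l) (list_op s u f) x)) -e1 e3 e2 -e4.
apply: (le_trans (cabsD _ _)); rewrite EFinD; apply: leeD.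
  by near: x.
by near: x.
Unshelve. all: by end_near. Qed.

End product.

(** * From each parameter to all parameters simultaneously *)

Section density.
Context (R : realType) (k : nat).

(** One point of B is picked from each nonempty intersection of B with a ball of
    rational centre and radius 1/(n+1). *)
Lemma countable_dense_subset (B : set 'rV[R]_k) :
  exists D, [/\ countable D, D `<=` B & B `<=` closure D].
Proof.
pose V (q : 'rV[rat]_k * nat) :=
  B `&` ball (map_mx ratr q.1 : 'rV[R]_k) q.2.+1%:R^-1.
exists [set xget 0 (V q) | q in [set q | V q !=set0]]; split.
- exact: sub_countable (card_image_le _ _) (countableP _).
- by move=> _ [q [t Vt] <-]; have [] := xgetPex 0 (ex_intro _ t Vt).
move=> t Bt U /nbhs_ballP[e /= e0 eU].
have [n ne] : exists n, (n.+1%:R^-1 < e / 2 :> R).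
  exists (Num.truncn (e / 2)^-1).
  by rewrite invf_plt ?posrE ?divr_gt0// truncnS_gt.
have n0 : 0 < n.+1%:R^-1 :> R by rewrite invr_gt0.
have /choice[q qP] : forall i : 'I_k, exists q : rat,
    ratr q \in `](t ord0 i - n.+1%:R^-1), (t ord0 i + n.+1%:R^-1)[.
  move=> i; apply: rat_in_itvoo.
  by rewrite ltrBlDr -addrA ltrDl addr_gt0.
pose Q := \row_i q i.
have tQ : ball (map_mx ratr Q : 'rV[R]_k) n.+1%:R^-1 t.
  split=> // i j; rewrite !mxE (ord1 i).
  have := qP j; rewrite in_itv /= => /andP[h1 h2].
  by rewrite /ball /= ltr_distl h1 h2.
have VQ : V (Q, n) t by split.
have [Bs Qs] := xgetPex 0 (ex_intro _ t VQ).
exists (xget 0 (V (Q, n))); split; first by exists (Q, n) => //; exists t.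
apply: eU; rewrite (splitr e).
apply: ball_triangle; last exact: (le_ball (ltW ne) Qs).
by apply: ball_sym; exact: (le_ball (ltW ne) tQ).
Qed.

Lemma within_continuous_le_closure (A D B : set 'rV[R]_k)
    (h : 'rV[R]_k -> R) M :
  B `<=` A -> D `<=` B -> B `<=` closure D -> {within A, continuous h} ->
  (forall s, D s -> h s <= M) -> forall t, B t -> h t <= M.
Proof.
move=> BA DB BD /subspace_continuousP ch hM t Bt.
rewrite leNgt; apply/negP => Mh.
have /= hn := cvgr_gt _ (ch t (BA t Bt)) _ Mh.
have [s [Ds /(_ (BA _ (DB _ Ds)))]] := BD t Bt _ (hn _).
by rewrite ltNge hM.
Qed.

End density.

Section versions.
Local Open Scope ereal_scope.
Context d (X : measurableType d) (R : realType)
  (mu : {measure set X -> \bar R}).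

(** Exceptional null sets may be united over countably many t; continuity in t
    reduces the general case to a countable dense set of them. *)
Lemma version_bound k (A B : set 'rV[R]_k) (F a : 'rV[R]_k -> X -> R[i]) u
    (M : X -> R) :
  is_version mu A F a -> countable A \/ ae_continuous mu A a ->
  B `<=` A -> A u ->
  (forall t, B t -> {ae mu, forall x, cabs (F t x - F u x)%R <= (M x)%:E}) ->
  {ae mu, forall x, forall t, B t -> cabs (a t x - a u x)%R <= (M x)%:E}.
Proof.
move=> va ca BA Au FM.
have aM t : B t -> {ae mu, forall x, cabs (a t x - a u x)%R <= (M x)%:E}.
  move=> Bt; apply: filterS3 (va t (BA _ Bt)) (va u Au) (FM t Bt) => x.
  by move=> -> ->.
have [cA|{}ca] := ca.
  apply: ae_countable aM; exact: sub_countable (subset_card_le BA) cA.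
have [D [cD DB BD]] := countable_dense_subset B.
have /ae_countable : forall t, D t ->
    {ae mu, forall x, cabs (a t x - a u x)%R <= (M x)%:E}.
  by move=> t Dt; exact/aM/DB.
move=> /(_ cD); apply: filterS2 ca => x [cr ci] DM t Bt.
pose h s : R := ComplexField.Normc.normc (a s x - a u x)%R.
suff : (h t <= M x)%R by rewrite -lee_fin.
apply: (@within_continuous_le_closure _ _ A D B h _ BA DB BD _ _ t Bt).
  rewrite (_ : h = (fun s => Num.sqrt
     ((complex.Re (a s x) - complex.Re (a u x)) ^+ 2 +
      (complex.Im (a s x) - complex.Im (a u x)) ^+ 2)))%R; last first.
    by apply/funext => s; rewrite /h; case: (a s x) (a u x) => [? ?] [? ?].
  apply/subspace_continuousP => s As.
  move/subspace_continuousP/(_ s As) : cr => hr.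
  move/subspace_continuousP/(_ s As) : ci => hi.
  apply: (@continuous_cvg _ _ _ _ _ _ (@Num.sqrt R)).
    exact: sqrt_continuous.
  by apply: cvgD; apply: cvgM; apply: cvgB => //; exact: cvg_cst.
by move=> s Ds; rewrite -lee_fin; exact: DM.
Qed.

End versions.

(** * The multi-parameter oscillation inequality *)

Theorem proposition4p1 (R : realType) (d : measure_display)
    (X : measurableType d) (mu : {sigma_finite_measure set X -> \bar R})
    (I : set R) (k : nat) (p r : R)
    (T : 'I_k -> R -> (X -> R[i]) -> (X -> R[i]))
    (I_two_points : exists s t : R, [/\ I s, I t & s <> t])
    (k_ge2 : (2 <= k)%N) (p_gt1 : 1 < p) (r_gt1 : 1 < r)
    (T_operator : forall i t, I t -> L0_operator mu (T i t))
    (T_commute : forall i j s t, I s -> I t -> L0_commute mu (T i s) (T j t))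
    (T_bounded : forall i t, I t -> Lp_bounded mu p (T i t))
    (T_continuous : ~ countable I -> forall i f, L0 mu f ->
      exists2 a : R -> X -> R[i],
        is_version mu I (fun t => T i t f) a & ae_continuous mu I a)
    (T_oscillation : forall i, oscillation_bound mu p r (@set_pow R I 1)
      (fun t : 'rV[R]_1 => T i (t ord0 ord0)))
    (T_maximal : forall i, vector_valued_max_bound mu p r I (T i)) :
  oscillation_bound mu p r (@set_pow R I k) (product_op T).
Proof.
have p0 : 0 < p by exact: lt_trans p_gt1.
have r0 : 0 < r by exact: lt_trans r_gt1.
have I0 : I !=set0 by have [s [_ [Is _ _]]] := I_two_points; exists s.
have [c c0 Hc] := list_op_oscillation p0 r0 I0 T_operator T_commute T_continuous
  T_oscillation T_maximal (index_enum 'I_k).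
exists (c `^ p^-1); split; first exact: powR_gt0.
move=> f Lpf a va ca.
apply: ge_ereal_sup => _ [J J0 <-]; apply: ge_ereal_sup => _ [tau tauP <-].
rewrite Lnorm_oscillation//.
have [G [[mG G0] eG dG]] := Hc f J tau Lpf J0 tauP.
have [tauI tau_lt] := tauP.
have aG : {ae mu, forall x, forall j, (j < J)%N -> forall t,
    (box (tau j) (tau j.+1) `&` @set_pow R I k) t ->
    (cabs (a t x - a (tau j) x)%R <= (G j x)%:E)%E}.
  apply: ae_foralln => j; case: (ltnP j J) => [jJ|_]; last exact: filterE.
  suff : {ae mu, forall x t, (box (tau j) (tau j.+1) `&` @set_pow R I k) t ->
      (cabs (a t x - a (tau j) x)%R <= (G j x)%:E)%E}.
    by apply: filterS => x H _.
  apply: (version_bound va ca); first by move=> t [].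
    exact: tauI (ltnW jJ).
  by move=> t [tbox It]; rewrite !product_opE; exact: dG.
have -> : Lp_norm mu p f = ((Lp_norm mu p f `^ p) `^ p^-1)%E.
  by rewrite poweRK ?gt_eqF// Lnorm_ge0.
apply: pow_le_root => //; first exact: ltW.
- by apply: integral_ge0 => x _; exact: poweR_ge0.
- exact: poweR_ge0.
apply: le_trans eG; apply: ae_le_lower_integral => [x|x|]; rewrite ?poweR_ge0//.
apply: filterS aG => x aG; apply: lee_poweR.
- by rewrite divr_ge0// ltW.
- apply: sume_ge0 => j _.
  apply: (@le_trans _ _ (cabs (a (tau j) x - a (tau j) x)%R `^ r)%E).
    exact: poweR_ge0.
  apply: ereal_sup_ubound; exists (tau j) => //.
  split; last exact: tauI (ltnW _).
  by move=> i; rewrite lexx; exact: tau_lt.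
apply: lee_sum => j _; apply: ge_ereal_sup => _ [t tB <-].
by apply: lee_poweR; [exact: ltW|exact: cabs_ge0|exact: aG].
Qed.
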